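(* Let $$\mathcal{G}_r=\begin{bmatrix} \partial_x&0 \\ \partial_{x^2}^2&0 \\ 0&\mathrm{Id} \end{bmatrix},\qquad \mathcal{G}_r^\dagger=\begin{bmatrix} -\partial_x&\partial_{x^2}^2&0 \\ 0&0&\mathrm{Id} \end{bmatrix}$$ be the transformation operator between the reduced implicit and explicit Euler--Bernoulli systems and its formal adjoint. For sufficiently smooth $(w,p_w)$, with explicit variables $\varepsilon_w=\partial_xw$ and, under the constraint $\phi=\partial_xw$, $\varepsilon_\phi=\partial_x\phi=\partial_{x^2}^2w$, one has $$\mathcal{G}_r\begin{bmatrix} w \\ p_w \end{bmatrix}=\begin{bmatrix} \varepsilon_w \\ \varepsilon_\phi \\ p_w \end{bmatrix},\qquad \mathcal{G}_r^\dagger\begin{bmatrix} \sigma_w \\ \sigma_\phi \\ v \end{bmatrix}=\begin{bmatrix} \delta_w\mathcal{H}_c^I \\ \delta_{p_w}\mathcal{H}_c^I \end{bmatrix},$$ and moreover $$\mathcal{G}_r\,\mathcal{J}_r^I\,\mathcal{G}_r^\dagger=\mathcal{J}_r^E.$$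
   Context: $\Omega=[a,b]$ is a bounded interval and $\rho,A,T_0,I,E$ are positive time-independent physical parameters; all operators are formal differential operators acting on sufficiently smooth functions. Reduced explicit Euler--Bernoulli system: $\partial_t(\varepsilon_w,\varepsilon_\phi,p_w)^\top=\mathcal{J}_r^E(\sigma_w,\sigma_\phi,v)^\top$ with $$\mathcal{J}_r^E=\begin{bmatrix} 0&0&\partial_x \\ 0&0&\partial_{x^2}^2 \\ \partial_x&-\partial_{x^2}^2&0 \end{bmatrix},\qquad \sigma_w=T_0\varepsilon_w,\quad \sigma_\phi=EI\,\varepsilon_\phi,\quad v=\frac{p_w}{\rho A}.$$ Reduced implicit Euler--Bernoulli system: $\partial_t(w,p_w)^\top=\mathcal{J}_r^I(\delta_w\mathcal{H}_c^I,\delta_{p_w}\mathcal{H}_c^I)^\top$ with $\mathcal{J}_r^I=\begin{bmatrix} 0&\mathrm{Id} \\ -\mathrm{Id}&0 \end{bmatrix}$, Hamiltonian $\mathcal{H}_c^I=\frac12\int_\Omega\big(\frac1{\rho A}p_w^2+T_0(\partial_xw)^2+EI(\partial^2_{x^2}w)^2\big)dx$ and $$\delta_w\mathcal{H}_c^I=-\partial_x(T_0\partial_xw)+\partial_{x^2}^2(EI\,\partial_{x^2}^2w),\qquad \delta_{p_w}\mathcal{H}_c^I=\frac{p_w}{\rho A}.$$ *)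

(* Defs.v *)
From HB Require Import structures.
From mathcomp Require Import all_boot all_order all_algebra.
From mathcomp Require Import all_classical all_reals all_analysis.
Set Implicit Arguments.
Unset Strict Implicit.
Unset Printing Implicit Defensive.
Import Order.TTheory GRing.Theory Num.Theory.
Import numFieldNormedType.Exports.
Local Open Scope classical_set_scope.
Local Open Scope ring_scope.

(* Functions on Omega = [a, b] are represented by total functions R -> R of
   which only the values on [a, b] matter: d_x f x below, for x in [a, b],
   looks at f on [a, b] only, so it is the one-sided derivative at the two
   endpoints and the ordinary derivative in between.  As usual for lim, it is
   unspecified when the difference quotient does not converge; smoothness is
   always a separate hypothesis. *)
Section Calculus.
Context {R : realType}.
Variables a b : R.
Implicit Types (f g : R -> R) (x : R).

Definition diff_quot f x : R -> R := fun y => (f y - f x) / (y - x).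

Definition in_Omega x : set_system R := within `[a, b] x^'.

Definition derivable_Omega f :=
  forall x, x \in `[a, b] -> cvg (diff_quot f x @ in_Omega x).

Definition dx f : R -> R := fun x => lim (diff_quot f x @ in_Omega x).

Definition dxx f : R -> R := dx (dx f).

Definition eq_Omega f g := {in `[a, b], f =1 g}.

(* f is of class C^n on [a, b] *)
Fixpoint Cn n f : Prop :=
  if n is n'.+1 then derivable_Omega f /\ Cn n' (dx f)
  else {within `[a, b], continuous f}.

Definition smooth f := forall n, Cn n f.

(* smooth with compact support in the open interval ]a, b[ *)
Definition test_fun f :=
  smooth f /\
  exists c d, [/\ a < c, c < d, d < b & forall x, x \notin `[c, d] -> f x = 0].

End Calculus.

(* Matrices of operators and column vectors of functions.  Sums, opposites and
   zeros of functions and of operators are the pointwise ones; the product of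
   operator matrices uses composition as the product of entries. *)
Section OperatorMatrices.
Context {R : realType}.

Definition fn := R -> R.
Definition op := fn -> fn.

Definition colv n (s : seq fn) : 'cV[fn]_n :=
  \col_(i < n) nth (fun=> 0) s i.

Definition opmx m n (rows : seq (seq op)) : 'M[op]_(m, n) :=
  \matrix_(i < m, j < n) nth (fun _ _ => 0) (nth [::] rows i) j.

Definition apply_opmx m n (P : 'M[op]_(m, n)) (u : 'cV[fn]_n) : 'cV[fn]_m :=
  \col_i (fun x => \sum_j P i j (u j 0) x).

Definition comp_opmx m n p (P : 'M[op]_(m, n)) (Q : 'M[op]_(n, p)) :
    'M[op]_(m, p) :=
  \matrix_(i, k) (fun f x => \sum_j P i j (Q j k f) x).

Variables a b : R.

Definition eqv_Omega n (u v : 'cV[fn]_n) :=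
  forall i, eq_Omega a b (u i 0) (v i 0).

(* equality of operator matrices of order at most k, as operators on C^k *)
Definition eq_opmx k m n (P Q : 'M[op]_(m, n)) :=
  forall i j f, Cn a b k f -> eq_Omega a b (P i j f) (Q i j f).

Definition inner n (u v : 'cV[fn]_n) : R :=
  \int[lebesgue_measure]_(x in `[a, b]) (\sum_i u i 0 x * v i 0 x).

Definition test_vec n (u : 'cV[fn]_n) := forall i, test_fun a b (u i 0).

Definition smooth_vec n (u : 'cV[fn]_n) := forall i, smooth a b (u i 0).

(* formal adjoint: no boundary terms, u having compact support *)
Definition formal_adjoint m n (P : 'M[op]_(m, n)) (Pd : 'M[op]_(n, m)) :=
  forall (u : 'cV[fn]_n) (v : 'cV[fn]_m), test_vec u -> smooth_vec v ->
    inner (apply_opmx P u) v = inner u (apply_opmx Pd v).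

(* g is the variational derivative of the functional F at u *)
Definition variational_derivative n (F : 'cV[fn]_n -> R) (u g : 'cV[fn]_n) :=
  forall eta : 'cV[fn]_n, test_vec eta ->
    is_derive (0 : R) 1
      (fun t : R => F (\col_i (fun x => u i 0 x + t * eta i 0 x)))
      (inner g eta).

End OperatorMatrices.

Arguments fn : clear implicits.
Arguments op : clear implicits.

Section EulerBernoulli.
Context {R : realType}.
Variables a b : R.
Local Notation d := (dx a b : op R).
Local Notation d2 := (dxx a b : op R).
Local Notation Id := ((fun f => f) : op R).
Local Notation O := ((fun _ _ => 0) : op R).
Local Notation "-o P" := ((fun f x => - (P : op R) f x) : op R) (at level 35).

Definition G_r : 'M[op R]_(3, 2) :=
  opmx 3 2 [:: [:: d;  O];
               [:: d2; O];
               [:: O;  Id]].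

Definition G_r_dag : 'M[op R]_(2, 3) :=
  opmx 2 3 [:: [:: -o d; d2; O];
               [:: O;    O;  Id]].

Definition J_rI : 'M[op R]_(2, 2) :=
  opmx 2 2 [:: [:: O;     Id];
               [:: -o Id; O]].

Definition J_rE : 'M[op R]_(3, 3) :=
  opmx 3 3 [:: [:: O; O;     d];
               [:: O; O;     d2];
               [:: d; -o d2; O]].

Variables rho A T0 I E : R -> R.

Definition hamiltonian_cI (u : 'cV[fn R]_2) : R :=
  let w := u 0 0 in let p := u 1 0 in
  2^-1 * \int[lebesgue_measure]_(x in `[a, b])
    ((rho x * A x)^-1 * p x ^+ 2 + T0 x * dx a b w x ^+ 2
     + E x * I x * dxx a b w x ^+ 2).

Definition delta_w_H (w : fn R) : fn R := fun x =>
  - dx a b (fun y => T0 y * dx a b w y) x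
  + dxx a b (fun y => E y * I y * dxx a b w y) x.

Definition delta_p_H (p : fn R) : fn R := fun x => p x / (rho x * A x).

End EulerBernoulli.

(* Main.v *)
Require Import Defs.
From HB Require Import structures.
From mathcomp Require Import all_boot all_order all_algebra.
From mathcomp Require Import all_classical all_reals all_analysis.
From mathcomp Require Import ring lra.
Set Implicit Arguments.
Unset Strict Implicit.
Unset Printing Implicit Defensive.
Import Order.TTheory GRing.Theory Num.Theory.
Import numFieldNormedType.Exports.
Local Open Scope classical_set_scope.
Local Open Scope ring_scope.

(* The operator identity and the action of [G_r], [G_r_dag] on the state are
   entrywise computations.  The adjunction is integration by parts: a test
   function and its derivative vanish at both endpoints, so there are no boundary
   terms.  Along w + t eta_w, p_w + t eta_p the Hamiltonian is a quadratic
   polynomial in t whose linear coefficient is the pairing of G_r eta with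
   (sigma_w, sigma_phi, v); the same integration by parts turns it into the
   pairing of eta with the claimed variational derivative. *)

(** * One-sided calculus on $[a,b]$: limits, algebra of $C^n$, fundamental theorem *)

Section DerivativeOnOmega.
Context {R : realType} (a b : R) (ltab : a < b).
Implicit Types (f g : R -> R) (x l : R) (m n : nat).

#[local] Instance in_Omega_filter x : Filter (in_Omega a b x).
Proof. exact: within_filter. Qed.

(** Since [a < b], every point of $[a,b]$ is a limit point of it, which makes limits along
    [in_Omega] unique. The nearby point lies to the right of [x] if [x < b] and to its left
    otherwise; [e / 2] keeps it in the ball, the other term of the minimum keeps it in $[a,b]$. *)
Lemma in_Omega_proper x : x \in `[a, b] -> ProperFilter (in_Omega a b x).
Proof.
rewrite in_itv/= => /andP[ax xb]; apply: Build_ProperFilter_ex => P.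
rewrite /in_Omega /within /dnbhs /within /= => /nbhs_ballP[e /= e0 eP].
have [xltb|bx] := ltP x b.
  exists (x + Num.min (e / 2) (b - x)).
  have m0 : 0 < Num.min (e / 2) (b - x) by rewrite lt_min; apply/andP; split; lra.
  have m1 : Num.min (e / 2) (b - x) <= e / 2 by rewrite ge_min lexx.
  have m2 : Num.min (e / 2) (b - x) <= b - x by rewrite ge_min lexx orbT.
  apply: eP; rewrite /= ?in_itv/=; [|by rewrite gt_eqF//; lra|by apply/andP; split; lra].
  by rewrite /ball /= opprD addrA subrr add0r normrN gtr0_norm //; lra.
exists (x - Num.min (e / 2) (x - a)).
have m0 : 0 < Num.min (e / 2) (x - a).
  by rewrite lt_min divr_gt0//= subr_gt0 (lt_le_trans ltab bx).
have m1 : Num.min (e / 2) (x - a) <= e / 2 by rewrite ge_min lexx.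
have m2 : Num.min (e / 2) (x - a) <= x - a by rewrite ge_min lexx orbT.
apply: eP; rewrite /= ?in_itv/=; [|by rewrite lt_eqF//; lra|by apply/andP; split; lra].
by rewrite /ball /= opprB addrC subrK gtr0_norm //; lra.
Qed.

Lemma near_in_Omega x : \forall y \near in_Omega a b x, y \in `[a, b] /\ y != x.
Proof.
rewrite /in_Omega /within /dnbhs /within; change (nbhs x (fun y =>
  y != x -> y \in `[a, b] -> y \in `[a, b] /\ y != x)).
by apply: filterE.
Qed.

Lemma dx_eq f x l : x \in `[a, b] ->
  diff_quot f x @ in_Omega a b x --> l -> dx a b f x = l.
Proof.
move=> xab fl; have := in_Omega_proper xab => ?.
exact: cvg_lim fl.
Qed.

Lemma diff_quot_eq_cvg f g x l : x \in `[a, b] -> eq_Omega a b f g ->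
  diff_quot f x @ in_Omega a b x --> l -> diff_quot g x @ in_Omega a b x --> l.
Proof.
move=> xab fg; apply: cvg_trans; apply: near_eq_cvg.
near=> y; rewrite /diff_quot fg ?fg//.
by have [] : y \in `[a, b] /\ y != x by near: y; exact: near_in_Omega.
Unshelve. all: by end_near. Qed.

(** The two difference quotients have the same image filter, so [lim] returns the same value even
    where they diverge. This allows rewriting under [dx] without a smoothness side condition. *)
Lemma eq_dx f g : eq_Omega a b f g -> eq_Omega a b (dx a b f) (dx a b g).
Proof.
move=> fg x xab; rewrite /dx; congr (lim _).
apply/seteqP; split => U; apply: near_eq_cvg; near=> y;
 rewrite /diff_quot !fg//;
 by have [] : y \in `[a, b] /\ y != x by near: y; exact: near_in_Omega.
Unshelve. all: by end_near. Qed.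

Lemma diff_quot_cvg_dx f x : derivable_Omega a b f -> x \in `[a, b] ->
  diff_quot f x @ in_Omega a b x --> dx a b f x.
Proof. by move=> df xab; exact: df. Qed.

Lemma eq_Cn n f g : eq_Omega a b f g -> Cn a b n f -> Cn a b n g.
Proof.
elim: n f g => [|n IHn] f g fg /=.
  move=> /subspace_continuousP cf; apply/subspace_continuousP => x xab.
  rewrite /from_subspace -(fg x xab); apply: cvg_trans (cf x xab).
  by apply: fmap_within_eq => y; rewrite inE => yab; exact/esym/fg.
move=> [df cf]; split; last exact: IHn (eq_dx fg) cf.
move=> x xab; apply/cvg_ex; exists (dx a b f x).
exact: diff_quot_eq_cvg fg (diff_quot_cvg_dx df xab).
Qed.

(** Passes from the punctured neighbourhoods of difference quotients to the unpunctured ones of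
    continuity: at [x] itself the value is already the limit. *)
Lemma cvg_in_Omega f x : x \in `[a, b] ->
  f @ in_Omega a b x --> f x -> f @ within `[a, b] (nbhs x) --> f x.
Proof.
move=> xab fx U Ux.
have : nbhs x (fun y => y != x -> y \in `[a, b] -> U (f y)) := fx _ Ux.
apply: filterS => y yU yab; have [->|/yU] := eqVneq y x; last exact.
exact: nbhs_singleton Ux.
Qed.

Lemma derivable_Omega_cvg f x : derivable_Omega a b f -> x \in `[a, b] ->
  f @ in_Omega a b x --> f x.
Proof.
move=> df xab.
(* The limit is put in the shape of $f(y) = f(x) + q(y)(y-x)$, where $q$ is the difference
   quotient. *)
have -> : f x = f x + dx a b f x * (x - x) by rewrite subrr mulr0 addr0.
have idx : id @ in_Omega a b x --> x.
  by apply: (cvg_trans (cvg_within _)); exact: cvg_within.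
apply: cvg_trans (cvgD (cvg_cst (f x)) (cvgM (diff_quot_cvg_dx df xab)
  (cvgB idx (cvg_cst x)))).
apply: near_eq_cvg; near=> y.
have [_ yx] : y \in `[a, b] /\ y != x by near: y; exact: near_in_Omega.
by rewrite /diff_quot /= !fctE /= mulfVK ?subr_eq0// addrC subrK.
Unshelve. all: by end_near. Qed.

Lemma derivable_Omega_continuous f :
  derivable_Omega a b f -> {within `[a, b], continuous f}.
Proof.
move=> df; apply/subspace_continuousP => x xab.
exact/cvg_in_Omega/derivable_Omega_cvg.
Qed.

Lemma CnS n f : Cn a b n.+1 f -> Cn a b n f.
Proof.
elim: n f => [|n IHn] f /=; first by move=> [/derivable_Omega_continuous].
by move=> [df cf]; split => //; exact: IHn.
Qed.

Lemma Cn_le m n f : (m <= n)%N -> Cn a b n f -> Cn a b m f.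
Proof.
move=> /subnK <-; elim: (n - m)%N => // k IHk; rewrite addSn => /CnS.
exact: IHk.
Qed.

Lemma diff_quot_cvgD f g x : x \in `[a, b] ->
  derivable_Omega a b f -> derivable_Omega a b g ->
  diff_quot (fun y => f y + g y) x @ in_Omega a b x -->
    dx a b f x + dx a b g x.
Proof.
move=> xab df dg.
apply: cvg_trans (cvgD (diff_quot_cvg_dx df xab) (diff_quot_cvg_dx dg xab)).
apply: near_eq_cvg; near=> y.
by rewrite /diff_quot /= !fctE /= -mulrDl; congr (_ / _); ring.
Unshelve. all: by end_near. Qed.

(** The numerator splits as $(f(y)-f(x))g(y) + f(x)(g(y)-g(x))$; the moving factor $g(y)$ is handled
    by continuity of [g] at [x]. *)
Lemma diff_quot_cvgM f g x : x \in `[a, b] ->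
  derivable_Omega a b f -> derivable_Omega a b g ->
  diff_quot (fun y => f y * g y) x @ in_Omega a b x -->
    dx a b f x * g x + f x * dx a b g x.
Proof.
move=> xab df dg.
apply: cvg_trans (cvgD
  (cvgM (diff_quot_cvg_dx df xab) (derivable_Omega_cvg dg xab))
  (cvgM (cvg_cst (f x)) (diff_quot_cvg_dx dg xab))).
apply: near_eq_cvg; near=> y.
rewrite /diff_quot /= !fctE /= mulrAC mulrA -mulrDl; congr (_ / _); ring.
Unshelve. all: by end_near. Qed.

Lemma dxD f g : derivable_Omega a b f -> derivable_Omega a b g ->
  eq_Omega a b (dx a b (fun y => f y + g y))
               (fun y => dx a b f y + dx a b g y).
Proof. by move=> df dg x xab; apply: dx_eq => //; exact: diff_quot_cvgD. Qed.

Lemma dxM f g : derivable_Omega a b f -> derivable_Omega a b g ->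
  eq_Omega a b (dx a b (fun y => f y * g y))
               (fun y => dx a b f y * g y + f y * dx a b g y).
Proof. by move=> df dg x xab; apply: dx_eq => //; exact: diff_quot_cvgM. Qed.

Lemma diff_quot_cvg_cst (c : R) x :
  diff_quot (fun=> c) x @ in_Omega a b x --> (0 : R).
Proof.
have -> : diff_quot (fun=> c) x = fun=> 0.
  by apply/funext => y; rewrite /diff_quot subrr mul0r.
exact: cvg_cst.
Qed.

Lemma dx_cst (c : R) : eq_Omega a b (dx a b (fun=> c)) (fun=> 0).
Proof. by move=> x xab; apply: dx_eq => //; exact: diff_quot_cvg_cst. Qed.

Lemma Cn_cst n (c : R) : Cn a b n (fun=> c).
Proof.
elim: n c => [|n IHn] c /=.
  by apply/subspace_continuousP => x xab; exact: cvg_cst.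
split; last by apply: eq_Cn (IHn 0) => x /dx_cst ->.
by move=> x xab; apply/cvg_ex; exists 0; exact: diff_quot_cvg_cst.
Qed.

Lemma CnD n f g : Cn a b n f -> Cn a b n g -> Cn a b n (fun x => f x + g x).
Proof.
elim: n f g => [|n IHn] f g /=.
  move=> /subspace_continuousP cf /subspace_continuousP cg.
  by apply/subspace_continuousP => x xab; apply: cvgD; [exact: cf|exact: cg].
move=> [df cf] [dg cg]; split.
  move=> x xab; apply/cvg_ex; exists (dx a b f x + dx a b g x).
  exact: diff_quot_cvgD.
by apply: eq_Cn (IHn _ _ cf cg) => x /(dxD df dg) ->.
Qed.

(** The product rule mixes each function with the derivative of the other, so the induction step
    also takes [f] and [g] themselves down one order by [CnS]. *)
Lemma CnM n f g : Cn a b n f -> Cn a b n g -> Cn a b n (fun x => f x * g x).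
Proof.
elim: n f g => [|n IHn] f g.
  move=> /subspace_continuousP cf /subspace_continuousP cg.
  by apply/subspace_continuousP => x xab; apply: cvgM; [exact: cf|exact: cg].
move=> cSf cSg; have [[df cf] [dg cg]] := (cSf, cSg); split.
  move=> x xab; apply/cvg_ex; exists (dx a b f x * g x + f x * dx a b g x).
  exact: diff_quot_cvgM.
apply: (@eq_Cn _ (fun x => dx a b f x * g x + f x * dx a b g x)).
  by move=> x /(dxM df dg) ->.
by apply: CnD; apply: IHn => //; exact: CnS.
Qed.

Lemma CnN n f : Cn a b n f -> Cn a b n (fun x => - f x).
Proof.
move=> cf; apply: eq_Cn (CnM (Cn_cst n (-1)) cf) => x _.
by rewrite mulN1r.
Qed.

Lemma dxZ (c : R) f : derivable_Omega a b f ->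
  eq_Omega a b (dx a b (fun y => c * f y)) (fun y => c * dx a b f y).
Proof.
move=> df x xab.
have [dc _] := Cn_cst 1 c.
by rewrite (dxM dc df)//= dx_cst// mul0r add0r.
Qed.

(** At an interior point the restriction to $[a,b]$ is vacuous nearby, so the limit is the ordinary
    two-sided one. *)
Lemma is_derive_dx f x : x \in `]a, b[ -> derivable_Omega a b f ->
  is_derive x 1 f (dx a b f x).
Proof.
move=> xab df.
have xab' : x \in `[a, b] by exact: subset_itv_oo_cc.
have fl : (fun h => h^-1 *: (f (h *: 1 + x) - f x)) @ 0^' --> dx a b f x.
  move=> U Ul.
  have H : \forall y \near x,
      y != x -> y \in `[a, b] -> U (diff_quot f x y).
    exact: diff_quot_cvg_dx df xab' _ Ul.
  have {H} : \forall y \near x, y != x -> U (diff_quot f x y).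
    near=> y => yx; apply: (near H y) => //.
    by apply: subset_itv_oo_cc; near: y; exact: near_in_itvoo.
  (* Change of variable $y = x + h$. *)
  rewrite (near_shift 0) => H.
  change (\forall h \near 0, h != 0 -> U (h^-1 *: (f (h *: 1 + x) - f x))).
  apply: filterS H => h /= H h0.
  move: H; rewrite /diff_quot/= subr0 addrK [_%:A]mulr1 [_ *: _]mulrC; apply.
  by rewrite -subr_eq0 addrK.
apply: DeriveDef.
  by apply/cvg_ex; exists (dx a b f x).
exact: cvg_lim fl.
Unshelve. all: by end_near. Qed.

(** The fundamental theorem of calculus asks for the ordinary derivative only in the open interval,
    together with one-sided continuity of [f] at the endpoints. *)
Lemma Rintegral_dx f : Cn a b 1 f ->
  \int[lebesgue_measure]_(x in `[a, b]) dx a b f x = f b - f a.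
Proof.
move=> [df cf].
rewrite /Rintegral (@continuous_FTC2 _ _ f)//.
  have /(continuous_within_itvP _ ltab)[_ fa fb] := derivable_Omega_continuous df.
  by split => // x xab; have [] := is_derive_dx xab df.
by move=> x xab; rewrite derive1E; apply/derive_val/is_derive_dx.
Qed.

Lemma Cn0_integrable f : Cn a b 0 f ->
  lebesgue_measure.-integrable `[a, b] (EFin \o f).
Proof.
by move=> cf; apply: continuous_compact_integrable => //; exact: segment_compact.
Qed.

End DerivativeOnOmega.

(** * Integration by parts against test functions *)

Section IntegrationByParts.
Context {R : realType} (a b : R) (ltab : a < b).
Implicit Types (f g u : R -> R).
Local Notation "\intO f" := (\int[lebesgue_measure]_(x in `[a, b]) f x)
  (at level 10, f at level 8).

Lemma Cn0V f : (forall x, x \in `[a, b] -> f x != 0) ->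
  Cn a b 0 f -> Cn a b 0 (fun x => (f x)^-1).
Proof.
move=> f0 /subspace_continuousP cf; apply/subspace_continuousP => x xab.
by apply: cvgV; [exact: f0|exact: cf].
Qed.

Lemma RintegralOD f g : Cn a b 0 f -> Cn a b 0 g ->
  \intO (fun x => f x + g x) = \intO f + \intO g.
Proof. by move=> cf cg; apply: RintegralD => //; exact: Cn0_integrable. Qed.

Lemma RintegralOZ (c : R) f : Cn a b 0 f ->
  \intO (fun x => c * f x) = c * \intO f.
Proof. by move=> cf; apply: RintegralZl => //; exact: Cn0_integrable. Qed.

Lemma eq_RintegralO f g : eq_Omega a b f g -> \intO f = \intO g.
Proof. by move=> fg; apply: eq_Rintegral => x; rewrite inE; exact: fg. Qed.

(** The difference of the two sides is the integral of $(fg)'$. Asking only that the products vanish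
    at the endpoints lets [f] be a test function or its derivative. *)
Lemma Rintegral_by_parts f g : Cn a b 1 f -> Cn a b 1 g ->
  f a * g a = 0 -> f b * g b = 0 ->
  \intO (fun x => dx a b f x * g x) = \intO (fun x => f x * - dx a b g x).
Proof.
move=> cf cg fga fgb.
have [[df cdf] [dg cdg]] := (cf, cg).
have cf0 := CnS cf; have cg0 := CnS cg.
have c1 : Cn a b 0 (fun x => dx a b f x * g x) by exact: CnM.
have c2 : Cn a b 0 (fun x => f x * - dx a b g x).
  by apply: CnM => //; exact: CnN.
apply/eqP; rewrite -subr_eq0 -mulN1r -RintegralOZ// -RintegralOD//; last first.
  by apply: CnM => //; exact: Cn_cst.
rewrite (@eq_RintegralO _ (dx a b (fun x => f x * g x))).
  by rewrite Rintegral_dx ?fga ?fgb ?subrr//; exact: CnM.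
by move=> x xab; rewrite (dxM ltab df dg)// mulrN mulN1r opprK.
Qed.

(** The support stays away from the endpoints, so near either of them [u], and with it the
    difference quotient, is identically zero. *)
Lemma test_fun_bnd u x : test_fun a b u -> x = a \/ x = b ->
  u x = 0 /\ dx a b u x = 0.
Proof.
move=> [_ [c [d [ac cd db u0]]]] xE.
have xab : x \in `[a, b] by rewrite in_itv/=; apply/andP; case: xE => ->; lra.
have xcd : x \notin `[c, d].
  rewrite in_itv/= negb_and -!ltNge; apply/orP.
  by case: xE => ->; [left|right].
split; first exact: u0.
have FF := in_Omega_filter a b x.
have c0 : (fun=> 0) @ in_Omega a b x --> (0 : R) by exact: cvg_cst.
apply: dx_eq => //; apply: cvg_trans c0.
apply: near_eq_cvg.
have : \forall y \near x, y \notin `[c, d].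
  case: xE => ->; [apply: filterS (lt_nbhsl ac)|apply: filterS (lt_nbhsr db)];
    by move=> y yP; rewrite in_itv/= negb_and -!ltNge yP ?orbT.
move=> H.
change (\forall y \near x, y != x -> y \in `[a, b] -> 0 = diff_quot u x y).
apply: filterS H => y ycd _ _.
by rewrite /diff_quot !u0// subrr mul0r.
Qed.

Lemma test_fun_by_parts u g : test_fun a b u -> Cn a b 1 g ->
  \intO (fun x => dx a b u x * g x) = \intO (fun x => u x * - dx a b g x).
Proof.
move=> tu cg; apply: Rintegral_by_parts => //; first by case: tu => /(_ 1).
  by have [-> _] := test_fun_bnd tu (or_introl erefl); rewrite mul0r.
by have [-> _] := test_fun_bnd tu (or_intror erefl); rewrite mul0r.
Qed.

(** Two integrations by parts, the first moving a derivative off [dx a b u], the second off [u]; the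
    two signs cancel. *)
Lemma test_fun_by_parts2 u g : test_fun a b u -> Cn a b 2 g ->
  \intO (fun x => dxx a b u x * g x) = \intO (fun x => u x * dxx a b g x).
Proof.
move=> tu cg; rewrite Rintegral_by_parts.
- have cdg : Cn a b 1 (fun x => - dx a b g x) by apply: CnN => //; case: cg.
  rewrite test_fun_by_parts//; apply: eq_RintegralO => x xab; congr (_ * _).
  have [ddg _] : Cn a b 1 (dx a b g) by case: cg.
  rewrite -mulN1r -dxZ//; last by case: cdg.
  by apply: eq_dx => // y _; rewrite mulN1r opprK.
- by case: tu => /(_ 2%N) [].
- exact: CnS.
- by have [_ ->] := test_fun_bnd tu (or_introl erefl); rewrite mul0r.
- by have [_ ->] := test_fun_bnd tu (or_intror erefl); rewrite mul0r.
Qed.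

(* Gives both the adjoint of [G_r] (any smooth g) and, with g = (sigma_w,
   sigma_phi, v), the first variation of the Hamiltonian. *)
Lemma G_r_by_parts u0 u1 g0 g1 g2 : test_fun a b u0 -> test_fun a b u1 ->
  Cn a b 1 g0 -> Cn a b 2 g1 -> Cn a b 0 g2 ->
  \intO (fun x => dx a b u0 x * g0 x + dxx a b u0 x * g1 x + u1 x * g2 x) =
  \intO (fun x => u0 x * (- dx a b g0 x + dxx a b g1 x) + u1 x * g2 x).
Proof.
move=> tu0 tu1 cg0 cg1 cg2.
have [cu0 cu1 cu2 cv0] : [/\ Cn a b 0 u0, Cn a b 0 (dx a b u0),
    Cn a b 0 (dxx a b u0) & Cn a b 0 u1].
  case: tu0 tu1 => su0 _ [su1 _].
  by have [_ [_ ?]] := su0 2%N; have [_ ?] := su0 1%N.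
have [_ cdg0] := cg0; have [_ [_ cddg1]] := cg1.
have cg00 := CnS cg0; have cg10 := CnS (CnS cg1).
have c02 : Cn a b 0 (fun x => u1 x * g2 x) by exact: CnM.
have c00 : Cn a b 0 (fun x => dx a b u0 x * g0 x) by exact: CnM.
have c01 : Cn a b 0 (fun x => dxx a b u0 x * g1 x) by exact: CnM.
have c10 : Cn a b 0 (fun x => u0 x * - dx a b g0 x) by apply: CnM => //; exact: CnN.
have c11 : Cn a b 0 (fun x => u0 x * dxx a b g1 x) by exact: CnM.
have c0 : Cn a b 0 (fun x => dx a b u0 x * g0 x + dxx a b u0 x * g1 x).
  exact: CnD.
have c1 : Cn a b 0 (fun x => u0 x * (- dx a b g0 x + dxx a b g1 x)).
  by apply: CnM => //; apply: CnD => //; exact: CnN.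
rewrite !RintegralOD// test_fun_by_parts// test_fun_by_parts2// -RintegralOD//.
by congr (_ + _); apply: eq_RintegralO => x _; rewrite mulrDr.
Qed.

End IntegrationByParts.

(** * Adjunction and factorization of the operator matrices *)

Section EulerBernoulliOperators.
Context {R : realType} (a b : R) (ltab : a < b).

(** Expanding a finite sum with [big_ord_recl] leaves iterated [lift]s as indices; these equations
    turn them back into numerals. *)
Lemma lift0_I2 : lift ord0 ord0 = 1 :> 'I_2. Proof. exact: val_inj. Qed.
Lemma lift0_I3 : lift ord0 ord0 = 1 :> 'I_3. Proof. exact: val_inj. Qed.
Lemma lift01_I3 : lift ord0 1 = 2%:R :> 'I_3.
Proof. exact: val_inj. Qed.

Definition opmxE := (lift01_I3, lift0_I3, lift0_I2, add0r, addr0).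

Lemma G_r_formal_adjoint : formal_adjoint a b (G_r a b) (G_r_dag a b).
Proof.
move=> u v tu sv.
have := G_r_by_parts ltab (tu 0) (tu 1) (sv 0 1%N) (sv 1 2%N) (sv 2%:R 0%N).
set l := LHS; set r := RHS => lr; rewrite /inner.
transitivity l; last transitivity r => //; apply: eq_RintegralO => x _;
  rewrite ?(big_ord_recl, big_ord0) !mxE ?(big_ord_recl, big_ord0) !mxE /=;
  by rewrite !opmxE ?addrA.
Qed.

(** Each entry of the composite reduces to a single surviving term or to zero. The vanishing terms
    include [dx] and [dxx] of the zero function, hence [dx0] and [dxx0]. *)
Lemma G_r_J_rI_G_r_dag k :
  eq_opmx a b k (comp_opmx (comp_opmx (G_r a b) (J_rI (R := R))) (G_r_dag a b))
                (J_rE a b).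
Proof.
have dx0 : eq_Omega a b (dx a b (fun=> 0)) (fun=> 0) by exact: dx_cst.
have dxx0 : eq_Omega a b (dxx a b (fun=> 0)) (fun=> 0).
  by move=> x xab; rewrite /dxx (eq_dx dx0) ?dx0.
move=> i j f _ x xab.
case: i j => [[|[|[|//]]] ilt] [[|[|[|//]]] jlt];
rewrite !mxE !(big_ord_recl, big_ord0) !mxE /= !(big_ord_recl, big_ord0) !mxE /=;
rewrite ?dx0 ?dxx0 ?opmxE ?oppr0 ?opprK//.
Qed.

Lemma is_derive0_quadratic (c0 c1 c2 : R) :
  is_derive (0 : R) 1 (fun t : R => c0 + c1 * t + c2 * t ^+ 2) c1.
Proof.
have -> : (fun t : R => c0 + c1 * t + c2 * t ^+ 2) =
    cst c0 + (c1 \*: id) + (c2 \*: (id ^+ 2)).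
  by apply/funext => t; rewrite !fctE.
apply: is_derive_eq.
by rewrite /= mulr0 scale0r scaler0 addr0 add0r [_%:A]mulr1.
Qed.

(** * First variation of the Hamiltonian *)

Section Hamiltonian.
Variables rho A T0 I E : R -> R.
Hypotheses (rho_gt0 : forall x, x \in `[a, b] -> 0 < rho x)
  (A_gt0 : forall x, x \in `[a, b] -> 0 < A x).
Hypotheses (rho_C0 : Cn a b 0 rho) (A_C0 : Cn a b 0 A) (T0_C1 : Cn a b 1 T0)
  (I_C2 : Cn a b 2 I) (E_C2 : Cn a b 2 E).

Lemma variational_derivative_H (w p : R -> R) : Cn a b 4 w -> Cn a b 0 p ->
  variational_derivative a b (hamiltonian_cI a b rho A T0 I E)
    (colv 2 [:: w; p])
    (colv 2 [:: delta_w_H a b T0 I E w; delta_p_H rho A p]).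
Proof.
move=> cw cp eta teta.
set ew := eta 0 0; set ep := eta 1 0.
have tew : test_fun a b ew by exact: teta.
have tep : test_fun a b ep by exact: teta.
have [dw [ddw cddw]] := cw.
have cdw3 : Cn a b 3 (dx a b w) := conj ddw cddw.
have cdw := Cn_le (isT : (1 <= 3)%N) cdw3.
have [sew _] := tew.
have cddew : Cn a b 0 (dxx a b ew) by have [_ []] := sew 2%N.
have cdew : Cn a b 0 (dx a b ew) by have [_] := sew 1%N.
have cep : Cn a b 0 ep by have [+ _] := tep => /(_ 0%N).
have cEI : Cn a b 2 (fun x => E x * I x) by exact: CnM.
have cEI0 := Cn_le (isT : (0 <= 2)%N) cEI.
have cT0 : Cn a b 0 T0 by exact: CnS.
have cV : Cn a b 0 (fun x => (rho x * A x)^-1).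
  apply: Cn0V; last exact: CnM.
  by move=> x xab; rewrite gt_eqF// mulr_gt0// ?rho_gt0 ?A_gt0.
have C2 f : Cn a b 0 f -> Cn a b 0 (fun x => f x ^+ 2).
  by move=> cf; exact: CnM.
(* [quad] is twice the energy density. [h0] and [h2] are its values at the state and at the
   variation, and [h1] is the associated bilinear form between the two. *)
pose quad (f g h : R -> R) x :=
  (rho x * A x)^-1 * f x ^+ 2 + T0 x * g x ^+ 2 + E x * I x * h x ^+ 2.
have cquad f g h : Cn a b 0 f -> Cn a b 0 g -> Cn a b 0 h ->
    Cn a b 0 (quad f g h).
  move=> cf cg ch.
  by apply: CnD => //; first apply: CnD => //; apply: CnM => //; exact: C2.
pose h0 := quad p (dx a b w) (dxx a b w).
pose h2 := quad ep (dx a b ew) (dxx a b ew).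
pose h1 x := dx a b ew x * (T0 x * dx a b w x) +
  dxx a b ew x * (E x * I x * dxx a b w x) + ep x * (p x / (rho x * A x)).
have cdw0 : Cn a b 0 (dx a b w) by exact: CnS.
have cddw2 : Cn a b 2 (dxx a b w) := cddw.
have cddw0 := Cn_le (isT : (0 <= 2)%N) cddw2.
have ch0 : Cn a b 0 h0 := cquad _ _ _ cp cdw0 cddw0.
have ch2 : Cn a b 0 h2 := cquad _ _ _ cep cdew cddew.
have cg0 : Cn a b 1 (fun x => T0 x * dx a b w x) := CnM ltab T0_C1 cdw.
have cg1 : Cn a b 2 (fun x => E x * I x * dxx a b w x) := CnM ltab cEI cddw2.
have cg2 : Cn a b 0 (fun x => p x / (rho x * A x)) := CnM ltab cp cV.
have cg10 := Cn_le (isT : (0 <= 2)%N) cg1.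
have ch1 : Cn a b 0 h1.
  have c01 := CnD ltab (CnM ltab cdew (CnS cg0)) (CnM ltab cddew cg10).
  have c2 := CnM ltab cep cg2.
  exact (CnD ltab c01 c2).
pose J f := \int[lebesgue_measure]_(x in `[a, b]) f x.
have -> : inner a b (colv 2 [:: delta_w_H a b T0 I E w; delta_p_H rho A p]) eta
    = J h1.
  (* [h1] pairs [G_r] applied to [eta] with $(\sigma_w,\sigma_\phi,v)$; all derivatives now move off
     [eta]. *)
  rewrite [RHS](G_r_by_parts ltab tew tep cg0 cg1 cg2).
  apply: eq_RintegralO => x _.
  rewrite !big_ord_recl big_ord0 !mxE /= opmxE /delta_w_H /delta_p_H.
  by rewrite -/ep -/ew addr0; congr (_ + _); exact: mulrC.
have -> : (fun t : R => hamiltonian_cI a b rho A T0 I E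
      (\col_i (fun x => colv 2 [:: w; p] i 0 x + t * eta i 0 x))) =
    (fun t => 2^-1 * J h0 + J h1 * t + (2^-1 * J h2) * t ^+ 2).
  apply/funext => t; rewrite /hamiltonian_cI !mxE /= -/ew -/ep.
  have dxt f g : Cn a b 1 f -> Cn a b 1 g ->
      eq_Omega a b (dx a b (fun x => f x + t * g x))
                   (fun x => dx a b f x + t * dx a b g x).
    move=> [df _] cg x xab; have [dg _] := cg.
    have [dtg _] : Cn a b 1 (fun x => t * g x) by apply: CnM => //; exact: Cn_cst.
    by rewrite (dxD ltab df dtg)// dxZ.
  have cw1 := Cn_le (isT : (1 <= 4)%N) cw.
  have cew1 : Cn a b 1 ew by exact: sew.
  have dxw := dxt _ _ cw1 cew1.
  have dxxw : eq_Omega a b (dxx a b (fun x => w x + t * ew x))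
      (fun x => dxx a b w x + t * dxx a b ew x).
    have [_ cdew1] : Cn a b 2 ew := sew 2%N.
    by move=> x xab; rewrite /dxx (eq_dx dxw xab) (dxt _ _ cdw cdew1 x xab).
  (* Expansion of the square: the cross term carries the factor $2t$, which the factor $1/2$ of the
     Hamiltonian reduces to $t$. *)
  rewrite (@eq_RintegralO _ a b _ (fun x => h0 x + ((t *+ 2) * h1 x + t ^+ 2 * h2 x))).
    have c1 : Cn a b 0 (fun x => (t *+ 2) * h1 x) := CnM ltab (Cn_cst ltab 0 _) ch1.
    have c2 : Cn a b 0 (fun x => t ^+ 2 * h2 x) := CnM ltab (Cn_cst ltab 0 _) ch2.
    rewrite (RintegralOD ch0 (CnD ltab c1 c2)) (RintegralOD c1 c2).
    rewrite (RintegralOZ _ ch1) (RintegralOZ _ ch2).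
    change (2^-1 * (J h0 + ((t *+ 2) * J h1 + t ^+ 2 * J h2)) =
      2^-1 * J h0 + J h1 * t + (2^-1 * J h2) * t ^+ 2).
    by move: (J h0) (J h1) (J h2) => j0 j1 j2; field.
  by move=> x xab; rewrite (dxw x xab) (dxxw x xab) /h0 /h1 /h2 /quad -/ep; ring.
exact: is_derive0_quadratic.
Qed.

End Hamiltonian.
End EulerBernoulliOperators.

Theorem mainTheorem12 (R : realType) (a b : R) (ltab : a < b)
  (rho A T0 I E : R -> R)
  (rho_gt0 : forall x, x \in `[a, b] -> 0 < rho x)
  (A_gt0 : forall x, x \in `[a, b] -> 0 < A x)
  (T0_gt0 : forall x, x \in `[a, b] -> 0 < T0 x)
  (I_gt0 : forall x, x \in `[a, b] -> 0 < I x)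
  (E_gt0 : forall x, x \in `[a, b] -> 0 < E x)
  (rho_C0 : Cn a b 0 rho) (A_C0 : Cn a b 0 A) (T0_C1 : Cn a b 1 T0)
  (I_C2 : Cn a b 2 I) (E_C2 : Cn a b 2 E) :
  formal_adjoint a b (G_r a b) (G_r_dag a b) /\
  (forall w p_w phi eps_w eps_phi sigma_w sigma_phi v : R -> R,
    Cn a b 4 w -> Cn a b 0 p_w ->
    eq_Omega a b eps_w (dx a b w) ->
    eq_Omega a b phi (dx a b w) ->
    eq_Omega a b eps_phi (dx a b phi) ->
    eq_Omega a b sigma_w (fun x => T0 x * eps_w x) ->
    eq_Omega a b sigma_phi (fun x => E x * I x * eps_phi x) ->
    eq_Omega a b v (fun x => p_w x / (rho x * A x)) ->
    [/\ eq_Omega a b eps_phi (dxx a b w),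
        eqv_Omega a b (apply_opmx (G_r a b) (colv 2 [:: w; p_w]))
                      (colv 3 [:: eps_w; eps_phi; p_w]),
        eqv_Omega a b (apply_opmx (G_r_dag a b)
                        (colv 3 [:: sigma_w; sigma_phi; v]))
                      (colv 2 [:: delta_w_H a b T0 I E w;
                                  delta_p_H rho A p_w]) &
        variational_derivative a b (hamiltonian_cI a b rho A T0 I E)
          (colv 2 [:: w; p_w])
          (colv 2 [:: delta_w_H a b T0 I E w; delta_p_H rho A p_w])]) /\
  eq_opmx a b 2 (comp_opmx (comp_opmx (G_r a b) (J_rI (R := R))) (G_r_dag a b))
                (J_rE a b).
Proof.
split; first exact: G_r_formal_adjoint.
split; last exact: G_r_J_rI_G_r_dag.
move=> w p_w phi eps_w eps_phi sigma_w sigma_phi v cw cp eps_wE phiE eps_phiE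
  sigma_wE sigma_phiE vE.
have eps_phi_dxx : eq_Omega a b eps_phi (dxx a b w).
  by move=> x xab; rewrite (eps_phiE x xab) (eq_dx phiE).
have sigma_w_dx : eq_Omega a b sigma_w (fun x => T0 x * dx a b w x).
  by move=> x xab; rewrite (sigma_wE x xab) (eps_wE x xab).
have sigma_phi_dxx : eq_Omega a b sigma_phi (fun x => E x * I x * dxx a b w x).
  by move=> x xab; rewrite (sigma_phiE x xab) (eps_phi_dxx x xab).
split; first exact: eps_phi_dxx.
- move=> i x xab; rewrite !mxE !big_ord_recl big_ord0 !mxE /=.
  case: i => [[|[|[|//]]] ?]; rewrite /= !opmxE//.
    by rewrite (eps_wE x xab).
  by rewrite (eps_phi_dxx x xab).
- move=> i x xab; rewrite !mxE !big_ord_recl big_ord0 !mxE /=.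
  case: i => [[|[|//]] ?]; rewrite /= !opmxE//.
    (* The constitutive laws hold only on $[a,b]$, so they are substituted under the derivatives
       through [eq_dx], twice for the second-order term. *)
    rewrite /delta_w_H (eq_dx sigma_w_dx xab) /dxx.
    by rewrite (eq_dx (eq_dx sigma_phi_dxx) xab).
  exact: vE.
- exact: variational_derivative_H.
Qed.
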